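(* Let $\beta>0$ and let $M,K\in\mathbb{R}^{m\times m}$ be the symmetric positive definite mass matrix and stiffness matrix arising from the $\mathbf{Q}_1$ (bilinear quadrilateral) finite element approximation with mesh size $h>0$ (as specified in the context), and let $c_1,c_2,d_1,d_2>0$ be constants, independent of $h$ and $\beta$, such that for every nonzero $\mathbf{x}\in\mathbb{R}^m$ $$c_1h^2\le\frac{\mathbf{x}^TM\mathbf{x}}{\mathbf{x}^T\mathbf{x}}\le c_2h^2,\qquad d_1h^2\le\frac{\mathbf{x}^TK\mathbf{x}}{\mathbf{x}^T\mathbf{x}}\le d_2.$$ Let $$\mathcal{A}=\begin{pmatrix}2\beta M&0&-M\\0&M&K^T\\-M&K&0\end{pmatrix},\qquad \mathcal{P}=\begin{pmatrix}0&K&0\\0&M&K^T\\-M&K&0\end{pmatrix}.$$ Then every eigenvalue $\lambda\neq1$ of $\mathcal{P}^{-1}\mathcal{A}$ satisfies $$2\beta+\frac{c_1^2h^4}{d_2^2}\le\lambda\le2\beta+\frac{c_2^2}{d_1^2}.$$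
   Context: Setting: $M$ and $K$ are the mass matrix and the stiffness matrix (discrete Laplacian) obtained from a Galerkin discretization, with bilinear quadrilateral ($\mathbf{Q}_1$) finite elements, of the optimal control problem $\min_{u,f}\frac12\|u-u_*\|_{L^2(\Omega)}^2+\beta\|f\|_{L^2(\Omega)}^2$ subject to $-\Delta u=f$ in a domain $\Omega\subset\mathbb{R}^2$ with $u=g$ on $\partial\Omega_1$ and $\partial u/\partial n=g$ on $\partial\Omega_2$, where $\partial\Omega=\partial\Omega_1\cup\partial\Omega_2$ is a disjoint union. Both $M$ and $K$ are symmetric positive definite in this setting. The mesh is a shape regular quadrilateral subdivision $\{\square_k\}$ of $\Omega$ which is quasi-uniform: with $h_k$ the diameter of $\square_k$, $\underline{h}=\min_kh_k$ and $h=\max_kh_k$, there is a constant $\rho>0$ with $\underline{h}\ge\rho h$ along the sequence of grids. Under these conditions it is a known result that constants $c_1,c_2,d_1,d_2$ as in the claim exist; the theorem uses them as given. *)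

(* Defs.v *)
From HB Require Import structures.
From mathcomp Require Import all_boot all_order all_algebra.
From mathcomp Require Import all_classical all_reals all_analysis.
From mathcomp Require Export complex.

Set Implicit Arguments.
Unset Strict Implicit.
Unset Printing Implicit Defensive.

Import Order.TTheory GRing.Theory Num.Theory.
Import numFieldNormedType.Exports.

Local Open Scope classical_set_scope.
Local Open Scope ring_scope.

Section Plane.
Variable R : realType.
Implicit Types (p q r x : R * R) (Q Omega : set (R * R)).

Definition cross p q r : R :=
  (q.1 - p.1) * (r.2 - p.2) - (q.2 - p.2) * (r.1 - p.1).

(* The Euclidean distance; the library norm on R * R is the sup norm. *)
Definition dist2 p q : R := Num.sqrt ((p.1 - q.1) ^+ 2 + (p.2 - q.2) ^+ 2).

Definition diam Q : R := sup [set dist2 z.1 z.2 | z in Q `*` Q].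

Definition segment2 p q : set (R * R) :=
  [set ((1 - t) * p.1 + t * q.1, (1 - t) * p.2 + t * q.2) | t in `[0, 1]].

Definition domain2 Omega : Prop :=
  [/\ Omega !=set0, open Omega, connected Omega & bounded_set Omega].

Definition frontier Omega : set (R * R) := closure Omega `\` interior Omega.

Definition lebesgue2 := (@lebesgue_measure R \x @lebesgue_measure R)%E.

(* Local node number a = 0, 1, 2, 3 sits at the corner (0,0), (1,0), (1,1),
   (0,1) of the reference square, and the arithmetic on 'I_4 is modulo 4. *)
Definition unit_square : set (R * R) := `[0, 1] `*` `[0, 1].

Definition q1_shape (a : 'I_4) x : R :=
  nth 0 [:: (1 - x.1) * (1 - x.2); x.1 * (1 - x.2);
            x.1 * x.2; (1 - x.1) * x.2] a.

Definition q1_map (P : 'I_4 -> R * R) x : R * R :=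
  (\sum_(a < 4) q1_shape a x * (P a).1, \sum_(a < 4) q1_shape a x * (P a).2).

(* Vertices in counterclockwise order with a left turn at each of them:
   a nondegenerate strictly convex quadrilateral. *)
Definition convex_quad (P : 'I_4 -> R * R) : Prop :=
  forall a, 0 < cross (P a) (P (a + 1)) (P (a - 1)).

(* Diameter of the circle inscribed in the triangle p q r, that is
   4 * area / perimeter. *)
Definition incircle_diam p q r : R :=
  2 * `|cross p q r| / (dist2 p q + dist2 q r + dist2 r p).

End Plane.

Section Q1.
Variable R : realType.

Record quad_mesh := QuadMesh {
  nvert : nat;
  nelt : nat;
  vcoord : 'I_nvert -> R * R;
  elt : 'I_nelt -> 'I_4 -> 'I_nvert
}.

Definition corner (T : quad_mesh) (k : 'I_(nelt T)) (a : 'I_4) : R * R :=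
  vcoord (elt k a).

Definition quad (T : quad_mesh) (k : 'I_(nelt T)) : set (R * R) :=
  q1_map (corner k) @` @unit_square R.

Definition edge (T : quad_mesh) (k : 'I_(nelt T)) (a : 'I_4) : set (R * R) :=
  segment2 (corner k a) (corner k (a + 1)).

(* Conforming subdivision of Omega into convex quadrilaterals. *)
Record subdivision (Omega : set (R * R)) (T : quad_mesh) : Prop := Subdivision {
  _ : injective (@vcoord T);
  _ : forall v : 'I_(nvert T), exists k, exists a, elt k a = v;
  _ : forall k : 'I_(nelt T), convex_quad (corner k);
  _ : closure Omega = \bigcup_(k in [set: 'I_(nelt T)]) quad k;
  _ : forall k l : 'I_(nelt T), k != l ->
        [\/ quad k `&` quad l = set0,
            exists a b, quad k `&` quad l = [set corner k a] /\
                        elt k a = elt l b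
          | exists a b, quad k `&` quad l = edge k a /\ edge k a = edge l b]
}.

Definition hk (T : quad_mesh) (k : 'I_(nelt T)) : R := diam (quad k).

Definition mesh_size (T : quad_mesh) : R := \big[Num.max/0]_(k < nelt T) hk k.

(* All h_k are at most mesh_size T, so this is the minimum of the h_k. *)
Definition min_size (T : quad_mesh) : R :=
  \big[Num.min/mesh_size T]_(k < nelt T) hk k.

(* Girault-Raviart shape regularity: the diameter of a quadrilateral is
   bounded by a fixed multiple of the smallest of the inscribed circles of the
   four triangles spanned by three consecutive vertices. *)
Definition shape_regular (T : nat -> quad_mesh) : Prop :=
  exists2 sigma : R, 0 < sigma &
    forall l (k : 'I_(nelt (T l))) (a : 'I_4),
      hk k <= sigma * incircle_diam (corner k a) (corner k (a + 1))
                                    (corner k (a - 1)).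

Definition quasi_uniform (T : nat -> quad_mesh) : Prop :=
  exists2 rho : R, 0 < rho & forall l, rho * mesh_size (T l) <= min_size (T l).

(* The values of phi outside of the closure of the domain are irrelevant. *)
Definition nodal_basis (T : quad_mesh) (phi : 'I_(nvert T) -> R * R -> R) :=
  forall v (k : 'I_(nelt T)) x, unit_square x ->
    phi v (q1_map (corner k) x) = \sum_(a < 4 | elt k a == v) q1_shape a x.

Record q1_space := Q1Space {
  mesh : quad_mesh;
  phi : 'I_(nvert mesh) -> R * R -> R;
  dimV : nat;
  node : 'I_dimV -> 'I_(nvert mesh)
}.

(* The trial and test space is spanned by the nodal basis functions that vanish
   on the Dirichlet part G1 of the boundary, numbered by [node]. *)
Record q1_discretization (Omega G1 : set (R * R)) (V : q1_space) : Prop :=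
  Q1Discretization {
  _ : subdivision Omega (mesh V);
  _ : nodal_basis (@phi V);
  _ : injective (@node V);
  _ : forall v, (exists i, node i = v) <-> (forall x, G1 x -> @phi V v x = 0)
}.

Definition basis (V : q1_space) (i : 'I_(dimV V)) : R * R -> R := phi (node i).

Definition mass_mx (Omega : set (R * R)) (V : q1_space) : 'M[R]_(dimV V) :=
  \matrix_(i, j) \int[@lebesgue2 R]_(x in Omega) (basis i x * basis j x).

(* The integrand is defined off the element edges, a null set. *)
Definition stiffness_mx (Omega : set (R * R)) (V : q1_space) :
    'M[R]_(dimV V) :=
  \matrix_(i, j) \int[@lebesgue2 R]_(x in Omega)
    ('D_(1, 0) (basis i) x * 'D_(1, 0) (basis j) x +
     'D_(0, 1) (basis i) x * 'D_(0, 1) (basis j) x).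

End Q1.

Section Matrices.
Variables (R : realType) (m : nat).
Implicit Types (M K A : 'M[R]_m) (x : 'cV[R]_m).

Definition quadform A x : R := (x^T *m A *m x) 0 0.

Definition spd A : Prop := A^T = A /\ forall x, x != 0 -> 0 < quadform A x.

Definition rayleigh A x : R := quadform A x / (x^T *m x) 0 0.

Definition saddle_mx (beta : R) M K : 'M[R]_(m + (m + m)) :=
  col_mx (row_mx ((2 * beta) *: M) (row_mx 0 (- M)))
 (col_mx (row_mx 0                 (row_mx M K^T))
         (row_mx (- M)             (row_mx K 0))).

Definition precond_mx M K : 'M[R]_(m + (m + m)) :=
  col_mx (row_mx 0     (row_mx K 0))
 (col_mx (row_mx 0     (row_mx M K^T))
         (row_mx (- M) (row_mx K 0))).

Lemma spd_unitmx A : spd A -> A \in unitmx.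
Proof.
move=> [_ Apos]; rewrite -unitmx_tr -row_free_unit -kermx_eq0.
apply/negPn/negP => /rowV0Pn[v /sub_kermxP vA v0].
have := Apos v^T; rewrite trmx_eq0 => /(_ v0).
by rewrite /quadform trmxK -mulmxA -[A]trmxK -trmx_mul vA trmx0 mulmx0 mxE ltxx.
Qed.


Lemma precond_mx_unit M K : spd M -> spd K -> precond_mx M K \in unitmx.
Proof.
move=> /spd_unitmx uM sK; have uK := spd_unitmx sK.
have inj (A : 'M[R]_m) (w : 'rV_m) : A \in unitmx -> w *m A = 0 -> w = 0.
  by move=> uA wA; rewrite -[w](mulmxK uA) wA mul0mx.
rewrite -row_free_unit -kermx_eq0; apply/eqP/row_matrixP => i.
rewrite row0; set v := row i _.
have : v *m precond_mx M K = 0 by apply/sub_kermxP; exact: row_sub.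
clearbody v; rewrite -[v]hsubmxK -[rsubmx v]hsubmxK.
move: (lsubmx v) (lsubmx (rsubmx v)) (rsubmx (rsubmx v)) => v1 v2 v3.
rewrite /precond_mx !mul_row_col !mul_mx_row !add_row_mx !mulmx0 ?add0r ?addr0.
move=> /eqP; rewrite !row_mx_eq0 => /and3P[/eqP e1 /eqP e2 /eqP e3].
have v30 : v3 = 0.
  by apply: (inj M) => //; apply/eqP; rewrite -oppr_eq0 -mulmxN e1.
have v20 : v2 = 0 by apply: (inj K^T) => //; rewrite unitmx_tr.
move: e2; rewrite v30 v20 !mul0mx !addr0 => /(inj _ _ uK) ->.
by rewrite !row_mx0.
Qed.

End Matrices.

(* Main.v *)
Require Import Defs.
From HB Require Import structures.
From mathcomp Require Import all_boot all_order all_algebra.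
From mathcomp Require Import all_classical all_reals all_analysis.
From mathcomp Require Import ring.

(** Eigenvalues are taken for row vectors acting from the left.  If [v] is such
an eigenvector of P^-1 A, then w = v P^-1 satisfies w A = lambda w P.  Writing
w = (w1, w2, w3), the first and the third block columns of this equation express
w3 and w2 through w1, because lambda <> 1; in particular w1 <> 0.  Substituting
them into the second block column leaves
     w1 (M K^-1 M) = (lambda - 2 beta) w1 K,
a generalized eigenvalue problem for a real symmetric matrix and a positive
definite one ([reduced_eigenproblem]).  Hence lambda - 2 beta is real and has a
real eigenvector x ([symmetric_pencil_real]), so it is the quotient of
(M x)^T K^-1 (M x) by x^T K x.

This quotient is bounded without a spectral theorem.  If the quadratic form of
a positive definite A lies between a |x|^2 and b |x|^2, the Cauchy-Schwarz
inequality, for the Euclidean product and for the product defined by A, gives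
a^2 |x|^2 <= |A x|^2 <= b^2 |x|^2 ([sqnorm_mulmx_bounds]) and
|y|^2 / b <= y^T A^-1 y <= |y|^2 / a ([quadform_invmx_bounds]).  With
a = c1 h^2, b = c2 h^2 for M and a = d1 h^2, b = d2 for K, the quotient lies
between (c1 h^2)^2 / (d2 d2) and (c2 h^2)^2 / (d1 h^2)^2. *)

Set Implicit Arguments.
Unset Strict Implicit.
Unset Printing Implicit Defensive.

Import Order.TTheory GRing.Theory Num.Theory.
Import numFieldNormedType.Exports.
Local Open Scope classical_set_scope.
Local Open Scope ring_scope.

(** * The Cauchy-Schwarz inequality of a positive definite matrix *)

Definition bilform (R : realType) m (A : 'M[R]_m) (x y : 'cV[R]_m) : R :=
  (x^T *m A *m y) 0 0.

Definition sqnorm (R : realType) m (x : 'cV[R]_m) : R := (x^T *m x) 0 0.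

Lemma sqnormE (R : realType) m (x : 'cV[R]_m) : sqnorm x = quadform 1%:M x.
Proof. by rewrite /quadform mulmx1. Qed.

Lemma sqnorm_gt0 (R : realType) m (x : 'cV[R]_m) : x != 0 -> 0 < sqnorm x.
Proof.
move=> x0; rewrite /sqnorm mxE; under eq_bigr do rewrite mxE -expr2.
rewrite lt_def sumr_ge0 ?andbT => [|i _]; last exact: sqr_ge0.
apply: contra x0; rewrite psumr_eq0 => [/allP x0|i _]; last exact: sqr_ge0.
apply/eqP/colP => i; rewrite mxE; apply/eqP; rewrite -sqrf_eq0.
exact: (x0 i (mem_index_enum i)).
Qed.

Lemma spd1 (R : realType) m : spd (1%:M : 'M[R]_m).
Proof.
by split=> [|x x0]; [exact: trmx1 | rewrite -sqnormE; exact: sqnorm_gt0].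
Qed.

Lemma quadform0 (R : realType) m (A : 'M[R]_m) : quadform A 0 = 0.
Proof. by rewrite /quadform mulmx0 mxE. Qed.

Lemma quadform_ge0 (R : realType) m (A : 'M[R]_m) x :
  spd A -> 0 <= quadform A x.
Proof.
by case=> _ Apos; have [->|/Apos/ltW//] := eqVneq x 0; rewrite quadform0.
Qed.

Lemma bilform_sym (R : realType) m (A : 'M[R]_m) x y :
  A^T = A -> bilform A x y = bilform A y x.
Proof.
move=> sA; rewrite /bilform.
have <- : (x^T *m A *m y)^T = y^T *m A *m x.
  by rewrite !trmx_mul trmxK sA mulmxA.
by rewrite [RHS]mxE.
Qed.

Lemma bilform_cauchy_schwarz (R : realType) m (A : 'M[R]_m) x y : spd A ->
  bilform A x y ^+ 2 <= quadform A x * quadform A y.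
Proof.
move=> pA; have [sA Apos] := pA; have [->|y0] := eqVneq y 0.
  by rewrite quadform0 mulr0 /bilform mulmx0 mxE expr0n.
set a := quadform A y; set b := bilform A x y.
have a0 : 0 < a by exact: Apos.
(* Up to the factor a, this vector is x minus its A-orthogonal projection
   on the line spanned by y. *)
have := quadform_ge0 (a *: x - b *: y) pA.
have -> : quadform A (a *: x - b *: y) = a * (quadform A x * a - b ^+ 2).
  have yx : bilform A y x = b by rewrite bilform_sym.
  rewrite [LHS](_ : _ = a * (a * quadform A x) - a * (b * b)
      - (b * (a * bilform A y x) - b * (b * a))); first by rewrite yx; ring.
  have tr : (a *: x - b *: y)^T = a *: x^T - b *: y^T.
    by apply/rowP => j; rewrite !mxE.
  rewrite [LHS]/quadform tr !mulmxBl !mulmxBr -!scalemxAl -!scalemxAr.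
  rewrite -/a -/b; have mE (C : 'M[R]_1) t : (t *: C) 0 0 = t * C 0 0.
    by rewrite mxE.
  have mB (C D : 'M[R]_1) : (C - D) 0 0 = C 0 0 - D 0 0 by rewrite !mxE.
  rewrite !(mB, mE) -[(x^T *m A *m x) 0 0]/(quadform A x).
  by rewrite -[(y^T *m A *m y) 0 0]/a -[(x^T *m A *m y) 0 0]/b.
by rewrite pmulr_rge0// subr_ge0.
Qed.

(** * Bounds on a matrix and its inverse from bounds on its quadratic form *)

(** Comparing with multiples of the squared norm instead of using the Rayleigh
quotient keeps the bounds meaningful at the zero vector. *)
Definition form_bounds (R : realType) m (A : 'M[R]_m) (a b : R) :=
  forall x, a * sqnorm x <= quadform A x <= b * sqnorm x.

Lemma rayleigh_form_bounds (R : realType) m (A : 'M[R]_m) (a b : R) :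
  (forall x : 'cV[R]_m, x != 0 -> a <= rayleigh A x <= b) -> form_bounds A a b.
Proof.
move=> H x; have [->|x0] := eqVneq x 0.
  by rewrite quadform0 /sqnorm mulmx0 mxE !mulr0 lexx.
by have := H x x0; rewrite ler_pdivlMr ?ler_pdivrMr //; exact: sqnorm_gt0.
Qed.

Lemma form_bounds_ub_gt0 (R : realType) m (A : 'M[R]_m) (a b : R)
    (x : 'cV[R]_m) :
  0 < a -> x != 0 -> form_bounds A a b -> 0 < b.
Proof.
move=> a0 x0 /(_ x)/andP[l u]; have n0 := sqnorm_gt0 x0.
rewrite -(pmulr_lgt0 _ n0); apply: lt_le_trans u; apply: lt_le_trans l.
exact: mulr_gt0.
Qed.

(** The lower bound is the Euclidean Cauchy-Schwarz inequality for x and A x,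
the upper bound the one of the product defined by A, for A x and x. *)
Lemma sqnorm_mulmx_bounds (R : realType) m (A : 'M[R]_m) (a b : R) (x : 'cV[R]_m) :
  spd A ->
  0 < a -> form_bounds A a b ->
  a ^+ 2 * sqnorm x <= sqnorm (A *m x) <= b ^+ 2 * sqnorm x.
Proof.
move=> pA a0 H; have [->|x0] := eqVneq x 0.
  by rewrite mulmx0 /sqnorm mulmx0 mxE !mulr0 lexx.
have b0 := form_bounds_ub_gt0 a0 x0 H; have n0 := sqnorm_gt0 x0.
have /andP[lx ux] := H x; apply/andP; split.
  have := bilform_cauchy_schwarz x (A *m x) (spd1 R m); rewrite -!sqnormE.
  have -> : bilform 1%:M x (A *m x) = quadform A x.
    by rewrite /bilform mulmx1 mulmxA.
  move=> cs; rewrite -(ler_pM2l n0); apply: le_trans cs.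
  have -> : sqnorm x * (a ^+ 2 * sqnorm x) = (a * sqnorm x) ^+ 2 by ring.
  by rewrite ler_sqr ?nnegrE ?mulr_ge0 ?(ltW a0) ?(ltW n0) ?quadform_ge0.
set y := A *m x; have [->|y0] := eqVneq y 0.
  by rewrite [leLHS]/sqnorm mulmx0 mxE mulr_ge0 ?sqr_ge0 ?(ltW n0).
have my := sqnorm_gt0 y0; have /andP[_ uy] := H y.
have := bilform_cauchy_schwarz y x pA.
have -> : bilform A y x = sqnorm y by rewrite /bilform -mulmxA.
move=> cs; rewrite -(ler_pM2l my) -expr2; apply: (le_trans cs).
have -> : sqnorm y * (b ^+ 2 * sqnorm x) = (b * sqnorm y) * (b * sqnorm x).
  by ring.
by apply: ler_pM => //; exact: quadform_ge0.
Qed.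

(** With y = A z the form of A^-1 at y is the form of A at z; the lower bound is
the Cauchy-Schwarz inequality of the product defined by A for y and z, the upper
bound the Euclidean one. *)
Lemma quadform_invmx_bounds (R : realType) m (A : 'M[R]_m) (a b : R) (y : 'cV[R]_m) :
  spd A ->
  0 < a -> 0 < b -> form_bounds A a b ->
  sqnorm y / b <= quadform (invmx A) y <= sqnorm y / a.
Proof.
move=> pA a0 b0 H; have uA := spd_unitmx pA; have [sA _] := pA.
set z := invmx A *m y; have yE : y = A *m z by rewrite mulKVmx.
have qE : quadform (invmx A) y = quadform A z.
  by rewrite /quadform -mulmxA -/z yE trmx_mul sA.
have zy : bilform 1%:M z y = quadform A z.
  by rewrite /bilform mulmx1 yE mulmxA.
have yz : bilform A y z = sqnorm y by rewrite /bilform -mulmxA -yE.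
rewrite qE; have [z0|z0] := eqVneq z 0.
  by rewrite z0 quadform0 yE z0 mulmx0 /sqnorm mulmx0 mxE !mul0r lexx.
have [_ Apos] := pA; have q0 := Apos z z0.
have y0 : y != 0.
  by apply: contra_neq z0 => y0; rewrite /z y0 mulmx0.
have n0 := sqnorm_gt0 y0.
have /andP[lz _] := H z; have /andP[_ uy] := H y.
rewrite ler_pdivrMr// ler_pdivlMr//; apply/andP; split.
  have := bilform_cauchy_schwarz y z pA; rewrite yz => cs.
  rewrite -(ler_pM2l n0) -expr2; apply: (le_trans cs).
  have -> : sqnorm y * (quadform A z * b) = b * sqnorm y * quadform A z by ring.
  by rewrite ler_pM2r.
have := bilform_cauchy_schwarz z y (spd1 R m); rewrite zy -!sqnormE => cs.
rewrite -(ler_pM2l q0) mulrA -expr2.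
apply: le_trans (_ : sqnorm z * sqnorm y * a <= _).
  by rewrite ler_pM2r.
have -> : sqnorm z * sqnorm y * a = a * sqnorm z * sqnorm y by ring.
by rewrite ler_pM2r.
Qed.

(** * Complex eigenvectors of real symmetric pencils *)

Section RealImaginaryParts.
Variables (R : realType).

Lemma Re_mulmx_real n m (x : 'rV[complex R]_n) (A : 'M[R]_(n, m)) :
  map_mx (@complex.Re R) (x *m map_mx (real_complex R) A) =
  map_mx (@complex.Re R) x *m A.
Proof.
apply/rowP => j; rewrite !mxE raddf_sum; apply: eq_bigr => i _ /=.
by rewrite !mxE; case: (x 0 i) => u v /=; ring.
Qed.

Lemma Im_mulmx_real n m (x : 'rV[complex R]_n) (A : 'M[R]_(n, m)) :
  map_mx (@complex.Im R) (x *m map_mx (real_complex R) A) =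
  map_mx (@complex.Im R) x *m A.
Proof.
apply/rowP => j; rewrite !mxE raddf_sum; apply: eq_bigr => i _ /=.
by rewrite !mxE; case: (x 0 i) => u v /=; ring.
Qed.

Lemma Re_scalemx n (t : complex R) (x : 'rV[complex R]_n) :
  map_mx (@complex.Re R) (t *: x) =
  complex.Re t *: map_mx (@complex.Re R) x
  - complex.Im t *: map_mx (@complex.Im R) x.
Proof. by apply/rowP => j; rewrite !mxE; case: t (x 0 j) => p q [u v]. Qed.

Lemma Im_scalemx n (t : complex R) (x : 'rV[complex R]_n) :
  map_mx (@complex.Im R) (t *: x) =
  complex.Re t *: map_mx (@complex.Im R) x
  + complex.Im t *: map_mx (@complex.Re R) x.
Proof.
by apply/rowP => j; rewrite !mxE; case: t (x 0 j) => p q [u v] /=; ring.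
Qed.

(** Let x = a + i b and t = p + i q.  Evaluating the real part of the equation at
b and its imaginary part at a, the symmetry of S leaves q (a K a + b K b) = 0. *)
Lemma symmetric_pencil_real m (S K : 'M[R]_m) (x : 'rV[complex R]_m)
    (t : complex R) :
  S^T = S -> spd K -> x != 0 ->
  x *m map_mx (real_complex R) S = t *: (x *m map_mx (real_complex R) K) ->
  complex.Im t = 0 /\
  exists2 a : 'cV[R]_m, a != 0 & S *m a = complex.Re t *: (K *m a).
Proof.
move=> sS pK x0 eqx; have [sK _] := pK.
have eqr := congr1 (map_mx (@complex.Re R)) eqx.
have eqi := congr1 (map_mx (@complex.Im R)) eqx.
rewrite Re_scalemx !Re_mulmx_real !Im_mulmx_real in eqr.
rewrite Im_scalemx !Re_mulmx_real !Im_mulmx_real in eqi.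
set p := complex.Re t in eqr eqi *; set q := complex.Im t in eqr eqi *.
have ab0 : (map_mx (@complex.Re R) x != 0) || (map_mx (@complex.Im R) x != 0).
  apply: contraR x0; rewrite negb_or !negbK => /andP[/eqP xr /eqP xi].
  apply/eqP/rowP => j; move/rowP/(_ j): xr; move/rowP/(_ j): xi.
  by rewrite !mxE; case: (x 0 j) => u v /= -> ->.
move: ab0 eqr eqi; rewrite -[map_mx (@complex.Re R) x]trmxK.
rewrite -[map_mx (@complex.Im R) x]trmxK.
set a := (map_mx (@complex.Re R) x)^T; set b := (map_mx (@complex.Im R) x)^T.
clearbody a b; rewrite !trmx_eq0 => ab0 eqr eqi.
have q0 : q = 0.
  have er : bilform S a b = p * bilform K a b - q * quadform K b.
    by rewrite /bilform eqr mulmxBl -!scalemxAl !mxE /quadform !mxE.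
  have ei : bilform S b a = p * bilform K b a + q * quadform K a.
    by rewrite /bilform eqi mulmxDl -!scalemxAl !mxE /quadform !mxE.
  have qQ : q * (quadform K a + quadform K b) = 0.
    move: er; rewrite bilform_sym // ei bilform_sym // => /eqP.
    by rewrite -subr_eq0 => /eqP <-; ring.
  move/eqP: qQ; rewrite mulf_eq0 => /orP[/eqP//|].
  rewrite paddr_eq0 ?quadform_ge0// => /andP[/eqP Ka /eqP Kb].
  by case/orP: ab0 => u0; have := pK.2 _ u0; rewrite ?Ka ?Kb ltxx.
have tr (u : 'cV[R]_m) : u^T *m S = p *: (u^T *m K) ->
    S *m u = p *: (K *m u).
  by move=> /(congr1 trmx); rewrite linearZ /= !trmx_mul trmxK sS sK.
rewrite q0 scale0r subr0 in eqr; rewrite q0 scale0r addr0 in eqi.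
split=> //; case/orP: ab0 => [a0|b0]; first by exists a => //; exact: tr.
by exists b => //; exact: tr.
Qed.

End RealImaginaryParts.

(** * The reduced eigenvalue problem *)

(** The block elimination: the first component x of v P^-1 determines the other
two, which is why it cannot vanish. *)
Lemma reduced_eigenproblem (R : realType) m (beta : R) (M K : 'M[R]_m) (lambda : complex R) :
  spd M -> spd K ->
  eigenvalue (map_mx (real_complex R)
    (invmx (precond_mx M K) *m saddle_mx beta M K)) lambda ->
  lambda != 1 ->
  exists2 x : 'rV[complex R]_m, x != 0 &
    x *m map_mx (real_complex R) (M *m invmx K *m M) =
    (lambda - real_complex R (2 * beta)) *: (x *m map_mx (real_complex R) K).
Proof.
move=> pM pK /eigenvalueP[v ev v0] l1.
have uP := precond_mx_unit pM pK; have uM := spd_unitmx pM.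
have uK := spd_unitmx pK; have [sK _] := pK.
set f := real_complex R in ev *.
have ufP : map_mx f (precond_mx M K) \in unitmx by rewrite map_unitmx.
have ufM : map_mx f M \in unitmx by rewrite map_unitmx.
have ufK : map_mx f K \in unitmx by rewrite map_unitmx.
pose w := v *m invmx (map_mx f (precond_mx M K)).
have vE : v = w *m map_mx f (precond_mx M K) by rewrite mulmxKV.
have w0 : w != 0 by apply: contra_neq v0 => w0; rewrite vE w0 mul0mx.
have : w *m map_mx f (saddle_mx beta M K) =
    lambda *: (w *m map_mx f (precond_mx M K)).
  by rewrite -vE -ev map_mxM map_invmx mulmxA.
clear ev; clearbody w; clear vE v v0; move: w0.
rewrite -[w]hsubmxK -[rsubmx w]hsubmxK.
move: (lsubmx w) (lsubmx (rsubmx w)) (rsubmx (rsubmx w)) => w1 w2 w3 w0.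
rewrite /precond_mx /saddle_mx sK !map_col_mx !map_row_mx !map_mxN !map_mx0.
rewrite map_mxZ !mul_row_col !mul_mx_row !add_row_mx !scale_row_mx.
rewrite !mulmx0 ?add0r ?addr0 !mulmxN -scalemxAr.
move=> /eq_row_mx[e1 /eq_row_mx[e2 e3]].
set A := map_mx f M in e1 e2 e3 ufM *; set B := map_mx f K in e1 e2 e3 ufK *.
set mu := 1 - lambda; have mu0 : mu != 0 by rewrite subr_eq0 eq_sym.
have e1' : f (2 * beta) *: w1 = mu *: w3.
  apply: (can_inj (mulmxK ufM)); rewrite -!scalemxAl /mu scalerBl scale1r.
  by move/eqP: e1; rewrite scalerN subr_eq addrC => /eqP.
have e3' : w1 *m A = mu *: (w2 *m B).
  by rewrite /mu scalerBl scale1r -e3 opprD opprK addrC addrNK.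
have e2' : mu *: (w2 *m A) + mu *: (w3 *m B) = lambda *: (w1 *m B).
  rewrite -scalerDr /mu scalerBl scale1r; apply/eqP; rewrite subr_eq.
  by rewrite {1}e2 scalerDr.
clearbody mu; exists w1.
  apply: contra_neq w0 => w10; rewrite w10 in e1' e3' *.
  have -> : w3 = 0.
    by apply/eqP; move/esym/eqP: e1'; rewrite scaler0 scaler_eq0 (negPf mu0).
  suff -> : w2 = 0 by rewrite !row_mx0.
  apply: (can_inj (mulmxK ufK)); rewrite mul0mx; apply/eqP.
  by move/esym/eqP: e3'; rewrite mul0mx scaler_eq0 (negPf mu0).
rewrite !map_mxM map_invmx -/A -/B !mulmxA e3' -!scalemxAl mulmxK //.
rewrite scalerBl -e2' [X in _ - X]scalemxAl e1' -scalemxAl.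
by rewrite addrK.
Qed.

(** A real number t with (M K^-1 M) x = t K x is the quotient of the form of K^-1
at M x by the form of K at x. *)
Lemma reduced_eigenvalue_bounds (R : realType) m (M K : 'M[R]_m)
    (a b c d t : R) (x : 'cV[R]_m) :
  spd M -> spd K -> 0 < a -> 0 < c -> 0 < d ->
  form_bounds M a b -> form_bounds K c d ->
  x != 0 -> M *m invmx K *m M *m x = t *: (K *m x) ->
  a ^+ 2 / d ^+ 2 <= t <= b ^+ 2 / c ^+ 2.
Proof.
move=> pM pK a0 c0 d0 HM HK x0 eqx; have [sM _] := pM.
have q0 := pK.2 x x0; have n0 := sqnorm_gt0 x0.
have tE : t * quadform K x = quadform (invmx K) (M *m x).
  rewrite /quadform trmx_mul sM -!mulmxA.
  rewrite !mulmxA in eqx *; rewrite -!mulmxA in eqx *.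
  by rewrite eqx -scalemxAr [RHS]mxE.
have /andP[l1 u1] := quadform_invmx_bounds (M *m x) pK c0 d0 HK.
have /andP[l2 u2] := sqnorm_mulmx_bounds x pM a0 HM.
have /andP[lK uK] := HK x.
rewrite -tE ler_pdivrMr // in l1; rewrite -tE ler_pdivlMr // in u1.
have tq : 0 < t.
  rewrite -(pmulr_lgt0 _ q0) -(pmulr_lgt0 _ d0); apply: lt_le_trans l1.
  by apply: lt_le_trans l2; rewrite mulr_gt0 ?exprn_gt0.
rewrite ler_pdivrMr ?exprn_gt0 // ler_pdivlMr ?exprn_gt0 //.
rewrite -(ler_pM2r n0) -[X in _ && X](ler_pM2r n0); apply/andP; split.
  apply: le_trans l2 _; apply: le_trans l1 _.
  have -> : t * d ^+ 2 * sqnorm x = t * (d * sqnorm x) * d by ring.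
  by rewrite ler_pM2r // ler_pM2l.
apply: le_trans u2; apply: le_trans u1.
have -> : t * c ^+ 2 * sqnorm x = t * (c * sqnorm x) * c by ring.
by rewrite ler_pM2r // ler_pM2l.
Qed.

Theorem theorem3 (R : realType)
    (Omega G1 G2 : set (R * R)) (V : nat -> q1_space R)
    (c1 c2 d1 d2 : R) :
  domain2 Omega ->
  G1 `|` G2 = frontier Omega -> G1 `&` G2 = set0 ->
  (forall l, q1_discretization Omega G1 (V l)) ->
  shape_regular (fun l => mesh (V l)) ->
  quasi_uniform (fun l => mesh (V l)) ->
  0 < c1 -> 0 < c2 -> 0 < d1 -> 0 < d2 ->
  (forall l, let h := mesh_size (mesh (V l)) in
             let M := mass_mx Omega (V l) in
             let K := stiffness_mx Omega (V l) in
     [/\ 0 < h, spd M, spd K &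
       forall x : 'cV[R]_(dimV (V l)), x != 0 ->
         c1 * h ^+ 2 <= rayleigh M x <= c2 * h ^+ 2 /\
         d1 * h ^+ 2 <= rayleigh K x <= d2]) ->
  forall (beta : R) (l : nat), 0 < beta ->
    let h := mesh_size (mesh (V l)) in
    let M := mass_mx Omega (V l) in
    let K := stiffness_mx Omega (V l) in
    forall lambda : complex R,
      eigenvalue (map_mx (real_complex R)
                    (invmx (precond_mx M K) *m saddle_mx beta M K)) lambda ->
      lambda != 1 ->
      complex.Im lambda = 0 /\
      2 * beta + c1 ^+ 2 * h ^+ 4 / d2 ^+ 2 <= complex.Re lambda
        <= 2 * beta + c2 ^+ 2 / d1 ^+ 2.
Proof.
move=> _ _ _ _ _ _ c10 c20 d10 d20 H beta l _ h M K lambda ev l1.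
have [h0 pM pK ray] := H l; rewrite -/h -/M -/K in h0 pM pK ray.
have HM : form_bounds M (c1 * h ^+ 2) (c2 * h ^+ 2).
  by apply: rayleigh_form_bounds => x /ray[].
have HK : form_bounds K (d1 * h ^+ 2) d2.
  by apply: rayleigh_form_bounds => x /ray[].
have [x x0 eqx] := reduced_eigenproblem pM pK ev l1.
have sS : (M *m invmx K *m M)^T = M *m invmx K *m M.
  by rewrite !trmx_mul trmx_inv pM.1 pK.1 mulmxA.
have [im0 [a a0 eqa]] := symmetric_pencil_real sS pK x0 eqx.
have ah0 : 0 < c1 * h ^+ 2 by rewrite mulr_gt0 ?exprn_gt0.
have ch0 : 0 < d1 * h ^+ 2 by rewrite mulr_gt0 ?exprn_gt0.
have := reduced_eigenvalue_bounds pM pK ah0 ch0 d20 HM HK a0 eqa.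
have -> : (c1 * h ^+ 2) ^+ 2 / d2 ^+ 2 = c1 ^+ 2 * h ^+ 4 / d2 ^+ 2.
  by rewrite exprMn -exprM.
have -> : (c2 * h ^+ 2) ^+ 2 / (d1 * h ^+ 2) ^+ 2 = c2 ^+ 2 / d1 ^+ 2.
  by field; rewrite !gt_eqF.
move: im0; case: (lambda) => p q /=; rewrite oppr0 addr0 => ->.
by rewrite lerBrDl lerBlDl.
Qed.
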